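(* Let $U$ be a unitary operator on the state space $(\mathbb{C}^2)^{\otimes n}$ of $n$ qubits, and let $A$ and $B$ be operators on the same space such that $U : A \to B$ in the Heisenberg interpretation, i.e. $U A U^{\dagger} = B$. Then $U$ takes every eigenstate of $A$ to an eigenstate of $B$: for every eigenstate $|\psi\rangle$ of $A$, the vector $U|\psi\rangle$ is an eigenstate of $B$.
   Context: In the Heisenberg representation, a unitary $U$ acts on operators by conjugation, $N \mapsto U N U^{\dagger}$, and the judgement $U : A \to B$ means $B = U A U^{\dagger}$. An eigenstate of an operator $N$ is a nonzero vector $|\psi\rangle$ with $N|\psi\rangle = \lambda|\psi\rangle$ for some $\lambda \in \mathbb{C}$. *)

(* Defs.v *)
From HB Require Import structures.
From mathcomp Require Import all_boot all_order all_algebra.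
From mathcomp Require Import sesquilinear spectral.
From mathcomp Require Import reals complex.

Set Implicit Arguments.
Unset Strict Implicit.
Unset Printing Implicit Defensive.

Import Order.TTheory GRing.Theory Num.Theory.
Local Open Scope ring_scope.
Local Open Scope complex_scope.
Local Open Scope sesquilinear_scope.

(* The complex numbers are R[i] with R : realType.
   (C^2)^{(x) n} is identified, via the computational basis, with the space of
   column vectors of length 2 ^ n; this is also the indexing of the n-fold
   tensor power in mathcomp.real_closed.mxtens. *)
Notation qubits R n := 'cV[R[i]]_(2 ^ n)%N (only parsing).
Notation qubit_operator R n := 'M[R[i]]_(2 ^ n)%N (only parsing).

(* The library's eigenspaces are those of the action on row vectors,
   whereas states are column vectors, acted on from the left. *)
Definition eigenstate (R : realType) (m : nat) (N : 'M[R[i]]_m)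
    (psi : 'cV[R[i]]_m) : Prop :=
  psi != 0 /\ exists lambda : R[i], N *m psi = lambda *: psi.

(* The judgement U : A -> B. *)
Definition heisenberg (R : realType) (m : nat) (U A B : 'M[R[i]]_m) : Prop :=
  B = U *m A *m U^t*.

(* Main.v *)
Require Import Defs.
From mathcomp Require Import all_boot all_order all_algebra.
From mathcomp Require Import sesquilinear spectral.
From mathcomp Require Import reals complex.

Import Order.TTheory GRing.Theory Num.Theory.
Local Open Scope ring_scope.

(** Since [U^t* U = 1], one has [B U psi = U A U^t* U psi = U A psi = lambda U psi]: the eigenvalue
    is preserved. *)

Theorem proposition1 (R : realType) (n : nat) (U A B : qubit_operator R n)
    (unitaryU : U \is unitarymx) (judgUAB : heisenberg U A B)
    (psi : qubits R n) (eigA : eigenstate A psi) :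
  eigenstate B (U *m psi).
Proof.
(* [unitarymx] gives [U U^t* = 1]; for square matrices a right inverse is also a left inverse. *)
have UadjU : U^t*%sesqui *m U = 1%:M by apply/mulmx1C/unitarymxP.
have [psi_neq0 [lambda Apsi]] := eigA.
split.
  (* [U] is injective: [U^t*] recovers [psi] from [U psi], so [U psi = 0] would force [psi = 0]. *)
  apply: contra_neq psi_neq0 => Upsi0.
  by rewrite -[psi]mul1mx -UadjU -mulmxA Upsi0 mulmx0.
exists lambda.
rewrite judgUAB -!mulmxA (mulmxA _ U psi) UadjU mul1mx Apsi.
exact/esym/scalemxAr.
Qed.
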